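(* Let $m>1$. Consider the half-duplex bi-directional multi-hop relay channel under the $(m,m+2)$ DF MHMR protocol described in the context, with durations $\Delta_1,\dots,\Delta_{m+2}\ge0$ summing to $1$. For any input distributions $p^{(i)}(x_{r_{m+2-i}})$, $i=1,\dots,m+2$ (so that the joint law is $\prod_{i=1}^{m+2}p^{(i)}(x_{r_{m+2-i}})p^{(i)}(y_{\mathcal R^*\setminus\{r_{m+2-i}\}}|x_{r_{m+2-i}})$), every rate pair $(R_a,R_b)$, $R_a,R_b\ge0$, with $$R_a<\min_{1\le k\le m+1}\sum_{i=1}^k\Delta_{m+3-i}\,I\big(X_{r_{i-1}}^{(m+3-i)};Y_{r_k}^{(m+3-i)}\big),$$ $$R_b<\min_{1\le k\le m+1}\sum_{i=1}^k\Delta_{i}\,I\big(X_{r_{m+2-i}}^{(i)};Y_{r_{m+1-k}}^{(i)}\big)$$ is achievable; i.e. the closure of the set of such pairs is an achievable rate region.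
   Context: Network: nodes $r_0=a,r_1,\dots,r_m,r_{m+1}=b$; $a,b$ are terminals, $\mathcal R=\{r_1,\dots,r_m\}$ the relays (in this given order), $\mathcal R^*=\{r_0,\dots,r_{m+1}\}$. Each node $r$ has finite input alphabet $\mathcal X_r$ and output alphabet $\mathcal Y_r$; $\varnothing$ means no input/no output. The $(m,m+2)$ MHMR protocol has $m+2$ phases: in phase $i$ ($1\le i\le m+2$) only node $r_{m+2-i}$ transmits and all other nodes receive, through the discrete memoryless channel $p^{(i)}(y_{\mathcal R^*\setminus\{r_{m+2-i}\}}|x_{r_{m+2-i}})$ (so phase $1$: $b$ transmits; phase $m+2$: $a$ transmits). $X_r^{(i)},Y_r^{(i)}$ denote the input/output of $r$ in a generic use of phase $i$. Messages $W_a$ (at $a$, wanted at $b$) and $W_b$ (at $b$, wanted at $a$) are independent, uniform on $\{0,\dots,\lfloor2^{nR_a}\rfloor-1\}$, $\{0,\dots,\lfloor2^{nR_b}\rfloor-1\}$. A code of length $n$ labels each channel use with a phase, $n_i$ uses having label $i$; in a use with label $i$ the transmitter's input is a function of its own message (if any) and its past outputs; $a$ decodes $\tilde W_b$ from its outputs and $W_a$, $b$ decodes $\tilde W_a$ similarly. $(R_a,R_b)$ is achievable for durations $(\Delta_i)$ if there are codes with $n_i/n\to\Delta_i$ for all $i$ and both error probabilities $\to0$. *)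

(* Defs.v *)
From HB Require Import structures.
From mathcomp Require Import all_boot all_order all_algebra.
From mathcomp Require Import all_classical all_reals all_analysis.
Set Implicit Arguments. Unset Strict Implicit. Unset Printing Implicit Defensive.
Import Order.TTheory GRing.Theory Num.Theory.
Import numFieldNormedType.Exports.
Local Open Scope classical_set_scope.
Local Open Scope ring_scope.

(* Nodes r_0 = a, r_1, ..., r_m, r_{m+1} = b are the ordinals of 'I_(m+2).
   Phases i = 1..m+2 are represented 0-based by p : 'I_(m+2), p = i-1.
   In phase p the only transmitter is r_{m+2-i} = r_{m+1-p} = rev_ord p. *)
Definition node_a (m : nat) : 'I_m.+2 := ord0.
Definition node_b (m : nat) : 'I_m.+2 := ord_max.
Definition tx (m : nat) (p : 'I_m.+2) : 'I_m.+2 := rev_ord p.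

Section MHMR.
Variable R : realType.
Variable m : nat.
Variables X Y : 'I_m.+2 -> finType.

(* one channel output symbol: the output of every node.  In phase p the
   coordinate of the transmitter tx p is a dummy that nobody ever observes. *)
Definition outs := {dffun forall j : 'I_m.+2, Y j}.
Definition hist (n : nat) := {ffun 'I_n -> outs}.

Definition channel := forall p : 'I_m.+2, X (tx p) -> outs -> R.

Definition stochastic (W : channel) :=
  (forall p x y, 0 <= W p x y) /\ (forall p x, \sum_(y : outs) W p x y = 1).

Definition is_distr (T : finType) (P : T -> R) :=
  (forall x, 0 <= P x) /\ \sum_(x : T) P x = 1.

Definition input_distrs := forall p : 'I_m.+2, X (tx p) -> R.

Definition log2 (z : R) : R := ln z / ln 2.

(* mutual information I(X_{tx p}^{(p)} ; Y_k^{(p)}) for input law Pp on the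
   transmitter's input and the receiver k (convention 0 log 0 = 0) *)
Definition mutinf (W : channel) (p : 'I_m.+2) (Pp : X (tx p) -> R)
    (k : 'I_m.+2) : R :=
  let joint := fun (x : X (tx p)) (yk : Y k) =>
      Pp x * \sum_(y : outs | y k == yk) W p x y in
  let py := fun yk : Y k => \sum_(x : X (tx p)) joint x yk in
  \sum_(x : X (tx p)) \sum_(yk : Y k | joint x yk != 0)
      joint x yk * log2 (joint x yk / (Pp x * py yk)).

Record code (n Ma Mb : nat) := Code {
  lab : 'I_n -> 'I_m.+2 ;
  enc : forall t : 'I_n, 'I_Ma -> 'I_Mb -> hist n -> X (tx (lab t)) ;
  dec_a : 'I_Ma -> hist n -> 'I_Mb ;
  dec_b : 'I_Mb -> hist n -> 'I_Ma
}.

Section CodeProps.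
Variables (n Ma Mb : nat) (c : code n Ma Mb).

(* node s observes the same outputs in y and y' at all uses before t
   (it observes only in uses where it is not the transmitter) *)
Definition same_past (s : 'I_m.+2) (t : 'I_n) (y y' : hist n) :=
  forall t' : 'I_n, (t' < t)%N -> tx (lab c t') != s -> y t' s = y' t' s.

Definition same_all (s : 'I_m.+2) (y y' : hist n) :=
  forall t' : 'I_n, tx (lab c t') != s -> y t' s = y' t' s.

(* the transmitter's input is a function of its own message (if any) and of
   its past outputs; decoders use their own message and their outputs *)
Definition valid_code :=
  [/\ (forall (t : 'I_n) wa wa' wb wb' (y y' : hist n),
         (tx (lab c t) = node_a m -> wa = wa') ->
         (tx (lab c t) = node_b m -> wb = wb') ->
         same_past (tx (lab c t)) t y y' ->
         enc c t wa wb y = enc c t wa' wb' y'),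
      (forall wa y y', same_all (node_a m) y y' -> dec_a c wa y = dec_a c wa y')
    & (forall wb y y', same_all (node_b m) y y' -> dec_b c wb y = dec_b c wb y')].

Definition jprob (W : channel) (wa : 'I_Ma) (wb : 'I_Mb) (y : hist n) : R :=
  (Ma%:R * Mb%:R)^-1 * \prod_(t : 'I_n) W (lab c t) (enc c t wa wb y) (y t).

Definition err_a (W : channel) : R :=
  \sum_(wa : 'I_Ma) \sum_(wb : 'I_Mb) \sum_(y : hist n | dec_a c wa y != wb)
     jprob W wa wb y.
Definition err_b (W : channel) : R :=
  \sum_(wa : 'I_Ma) \sum_(wb : 'I_Mb) \sum_(y : hist n | dec_b c wb y != wa)
     jprob W wa wb y.

Definition nphase (p : 'I_m.+2) : nat := #|[set t : 'I_n | lab c t == p]|.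

End CodeProps.

Definition msize (Rt : R) (n : nat) : nat := Num.truncn (expR (n%:R * Rt * ln 2)).

Definition achievable (W : channel) (Delta : 'I_m.+2 -> R) (Ra Rb : R) :=
  exists C : forall n : nat, code n (msize Ra n) (msize Rb n),
    [/\ forall n, valid_code (C n),
        forall p : 'I_m.+2,
          (fun n : nat => (nphase (C n) p)%:R / n%:R) @ \oo --> Delta p,
        (fun n : nat => err_a (C n) W) @ \oo --> (0 : R)
      & (fun n : nat => err_b (C n) W) @ \oo --> (0 : R)].

(* k-th term of the min defining the bound on R_a (1 <= k <= m+1):
   sum_{i=1}^k Delta_{m+3-i} I(X_{r_{i-1}}^{(m+3-i)} ; Y_{r_k}^{(m+3-i)}).
   With j = i-1, phase m+3-i is 0-based rev_ord j, whose transmitter is r_j. *)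
Definition bound_a (W : channel) (P : input_distrs) (Delta : 'I_m.+2 -> R)
    (k : 'I_m.+2) : R :=
  \sum_(j : 'I_m.+2 | (j < k)%N)
     Delta (rev_ord j) * mutinf W (P (rev_ord j)) k.

(* k-th term of the min defining the bound on R_b (1 <= k <= m+1):
   sum_{i=1}^k Delta_i I(X_{r_{m+2-i}}^{(i)} ; Y_{r_{m+1-k}}^{(i)}).
   With p = i-1 (0-based phase), the receiver r_{m+1-k} is rev_ord k. *)
Definition bound_b (W : channel) (P : input_distrs) (Delta : 'I_m.+2 -> R)
    (k : 'I_m.+2) : R :=
  \sum_(p : 'I_m.+2 | (p < k)%N) Delta p * mutinf W (P p) (rev_ord k).

End MHMR.

(* Main.v *)
(* Time is cut into D + m blocks, each running through the m + 2 phases, and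
   either message into D digits.  In block s, node r_j sends a random codeword
   indexed by digit s - j of W_a and digit s of W_b: W_a advances one hop per
   block, while W_b crosses the whole network within a block.  When r_k decodes
   digit i of W_a from the codewords of r_0, ..., r_(k-1) in blocks i, ..., i+k-1
   it already knows the digits of W_b mixed into them, and symmetrically, so
   each digit is decoded at single-user rate and mutual informations add up over
   the transmitters heard.  A node tests likelihood ratios against thresholds:
   a wrong digit passes with small probability by Markov's inequality (the
   likelihood ratio has mean at most 1 under independence), the true one fails
   with small probability by a Chernoff bound.  As long as no test misfires, all
   nodes send what a genie knowing the messages would have them send.  The rate
   loss D / (D + m) is absorbed by the strict inequalities. *)

Require Import Defs.
From HB Require Import structures.
From mathcomp Require Import all_boot all_order all_algebra.
From mathcomp Require Import all_classical all_reals all_analysis.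
From mathcomp Require Import ring lra zify.
Import Order.TTheory GRing.Theory Num.Theory numFieldNormedType.Exports.
Local Open Scope ring_scope.
Set Implicit Arguments. Unset Strict Implicit. Unset Printing Implicit Defensive.

(** * Finite sums, product laws and causal kernels *)

(** Dependent distributivity: the input alphabet changes with the transmitter, so a codebook is an
    element of a dependent product. *)
Lemma prod_sum_fprod (R : comPzSemiRingType) (I : finType) (T_ : I -> finType)
    (g : forall i, T_ i -> R) :
  \prod_i \sum_(x : T_ i) g i x = \sum_(f : fprod T_) \prod_i g i (f i).
Proof.
pose G i : {ffun T_ i -> R} := [ffun x => g i x].
transitivity (\prod_i \sum_(x : T_ i) G i x).
  by apply: eq_bigr => i _; apply: eq_bigr => x _; rewrite ffunE.
transitivity (\sum_(f : fprod T_) \prod_i G i (f i)); last first.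
  by apply: eq_bigr => f _; apply: eq_bigr => i _; rewrite ffunE.
rewrite big_fprod; transitivity
    (\prod_i \sum_(j in tagged_with T_ i) untag 0 (fun x => G i x) j).
  by apply: eq_bigr => i _; exact: (big_tag (fun i x => G i x) i).
by rewrite (bigA_distr_big_dep (fun i => tagged_with T_ i)).
Qed.

Lemma sum_prod_codebook (R : comPzSemiRingType) (n : nat) (C O : finType)
    (X' : 'I_n -> finType) (h : forall t, {ffun C -> X' t} -> O -> R) :
  \sum_(F : fprod (fun t => {ffun C -> X' t} : finType))
     \sum_(y : {ffun 'I_n -> O}) \prod_t h t (F t) (y t)
  = \prod_t \sum_(f : {ffun C -> X' t}) \sum_(o : O) h t f o.
Proof.
rewrite (prod_sum_fprod (fun t f => \sum_(o : O) h t f o)).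
by apply: eq_bigr => F _; rewrite bigA_distr_bigA.
Qed.

Section Marginals.
Variables (R : comPzSemiRingType) (C T : finType) (Q : T -> R).
Hypothesis Q1 : \sum_x Q x = 1.

(** Codewords with distinct indices are independent; every other coordinate sums out to 1. *)
Lemma iid_marginal2 (c0 c1 : C) (g h : T -> R) : c0 != c1 ->
  \sum_(f : {ffun C -> T}) (\prod_c Q (f c)) * (g (f c0) * h (f c1))
  = (\sum_x Q x * g x) * (\sum_x Q x * h x).
Proof.
move=> c01.
pose k c x := Q x * (if c == c0 then g x else 1) * (if c == c1 then h x else 1).
transitivity (\sum_(f : {ffun C -> T}) \prod_c k c (f c)).
  apply: eq_bigr => f _; rewrite /k !big_split /= -mulrA; congr (_ * (_ * _)).
    by rewrite -big_mkcond big_pred1_eq.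
  by rewrite -big_mkcond big_pred1_eq.
rewrite -bigA_distr_bigA (bigD1 c0) //= (bigD1 c1) /=; last by rewrite eq_sym.
rewrite [X in _ * (_ * X)]big1 ?mulr1.
  congr (_ * _); apply: eq_bigr => x _; rewrite /k eqxx.
    by rewrite (negbTE c01) mulr1.
  by rewrite eq_sym (negbTE c01) mulr1.
move=> c /andP[/negbTE c0' /negbTE c1']; rewrite -[RHS]Q1.
by apply: eq_bigr => x _; rewrite /k c0' c1' !mulr1.
Qed.

Lemma iid_marginal (c0 : C) (g : T -> R) :
  \sum_(f : {ffun C -> T}) (\prod_c Q (f c)) * g (f c0) = \sum_x Q x * g x.
Proof.
pose k c x := Q x * (if c == c0 then g x else 1).
transitivity (\sum_(f : {ffun C -> T}) \prod_c k c (f c)).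
  apply: eq_bigr => f _; rewrite /k !big_split /=; congr (_ * _).
  by rewrite -big_mkcond big_pred1_eq.
rewrite -bigA_distr_bigA (bigD1 c0) //= [X in _ * X]big1 ?mulr1.
  by apply: eq_bigr => x _; rewrite /k eqxx.
move=> c /negbTE c0'; rewrite -[RHS]Q1.
by apply: eq_bigr => x _; rewrite /k c0' !mulr1.
Qed.

End Marginals.

(** The last output is summed out first: by causality the earlier factors do not see it, and its own
    kernel has mass 1. [o0] fills the last coordinate when kernels are restricted to shorter
    histories. *)
Lemma causal_prod_sum1 (R : comPzSemiRingType) (n : nat) (O : finType)
    (V : 'I_n -> {ffun 'I_n -> O} -> O -> R) (o0 : O) :
  (forall t y, \sum_o V t y o = 1) ->
  (forall (t : 'I_n) (y y' : {ffun 'I_n -> O}),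
     (forall t' : 'I_n, (t' < t)%N -> y t' = y' t') -> V t y =1 V t y') ->
  \sum_(y : {ffun 'I_n -> O}) \prod_t V t y (y t) = 1.
Proof.
elim: n V => [|n IHn] V V1 Vc.
  rewrite (eq_bigr (fun=> 1)) => [|y _]; last by rewrite big_ord0.
  by rewrite sumr_const card_ffun card_ord expn0.
pose ext (z : {ffun 'I_n -> O} * O) : {ffun 'I_n.+1 -> O} :=
  [ffun t => oapp z.1 z.2 (unlift ord_max t)].
pose res (y : {ffun 'I_n.+1 -> O}) := ([ffun t => y (lift ord_max t)], y ord_max).
have resK : cancel res ext.
  move=> y; apply/ffunP => t; rewrite ffunE.
  by case: unliftP => [u|] ->; rewrite /= ?ffunE.
have extK : cancel ext res.
  move=> [z o]; congr (_, _); last by rewrite ffunE unlift_none.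
  by apply/ffunP => t; rewrite !ffunE liftK.
rewrite (reindex ext) /=; last by exists res => y _; [exact: extK | exact: resK].
rewrite -(pair_big xpredT xpredT
  (fun z o => \prod_(t < n.+1) V t (ext (z, o)) (ext (z, o) t))) /=.
have extl z o t : ext (z, o) (widen_ord (leqnSn n) t) = z t.
  rewrite ffunE; have -> : widen_ord (leqnSn n) t = lift ord_max t.
    by apply: val_inj; rewrite /= /bump leqNgt ltn_ord.
  by rewrite liftK.
have extr z o : ext (z, o) ord_max = o by rewrite ffunE unlift_none.
rewrite -[RHS](IHn (fun t z => V (widen_ord (leqnSn n) t) (ext (z, o0)))) => [|t z|t z z' zz'].
- apply: eq_bigr => z _.
  transitivity (\sum_o (\prod_(t < n) V (widen_ord (leqnSn n) t) (ext (z, o0)) (z t))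
     * V ord_max (ext (z, o0)) o).
    apply: eq_bigr => o _; rewrite big_ord_recr /= extr; congr (_ * _).
      apply: eq_bigr => t _; rewrite extl; apply: Vc => t' t't.
      have t'n : (t' < n)%N by exact: ltn_trans (ltn_ord t).
      have -> : t' = widen_ord (leqnSn n) (Ordinal t'n) by exact: val_inj.
      by rewrite !extl.
    apply: Vc => t' t't.
    have -> : t' = widen_ord (leqnSn n) (Ordinal t't) by exact: val_inj.
    by rewrite !extl.
  by rewrite -big_distrr /= V1 mulr1.
- exact: V1.
- apply: Vc => t' t't.
  have t'n : (t' < n)%N by exact: ltn_trans (ltn_ord t).
  have -> : t' = widen_ord (leqnSn n) (Ordinal t'n) by exact: val_inj.
  by rewrite !extl; exact: zz'.
Qed.

(** Combines [expR x <= 1 / (1 - x)] with [(1 + x + 2 * x^2) * (1 - x) = 1 + x^2 * (1 - 2 * x)]. *)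
Lemma expR_le_quadratic (R : realType) (x : R) :
  x <= 2^-1 -> expR x <= 1 + x + 2 * x ^+ 2.
Proof.
move=> x2; have h := expR_ge1Dx (- x).
have x1 : 0 < 1 - x by lra.
have -> : expR x = (expR (- x))^-1 by rewrite expRN invrK.
apply: (@le_trans _ _ (1 - x)^-1).
  by rewrite lef_pV2 ?posrE ?expR_gt0.
rewrite -(ler_pM2r x1) mulVf ?gt_eqF //.
have : 0 <= x ^+ 2 * (1 - 2 * x) by rewrite mulr_ge0 ?sqr_ge0 //; lra.
nra.
Qed.

(** The step from a random codebook to a fixed one. If every [f x] exceeded [e], the nonnegative
    terms [mu x * (f x - e)] would all vanish, forcing [mu = 0]. *)
Lemma le_weighted_avg (R : realDomainType) (T : finType) (mu f : T -> R) (e : R) :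
  (forall x, 0 <= mu x) -> \sum_x mu x = 1 -> \sum_x mu x * f x <= e ->
  exists x, f x <= e.
Proof.
move=> mu0 mu1 fe; apply/existsP; apply: contraT; rewrite negb_exists => /forallP fe'.
have fe0 x : 0 <= f x - e by rewrite subr_ge0 ltW // ltNge fe'.
have s0 : \sum_x mu x * (f x - e) = 0.
  apply/eqP; rewrite eq_le sumr_ge0 ?andbT; last by move=> x _; rewrite mulr_ge0.
  under eq_bigr do rewrite mulrBr.
  by rewrite sumrB -mulr_suml mu1 mul1r subr_le0.
have /eqP := mu1; rewrite big1 ?(eq_sym 0) ?oner_eq0 // => x _.
have /psumr_eq0P/(_ s0 x isT)/eqP : forall x, predT x -> 0 <= mu x * (f x - e).
  by move=> z _; rewrite mulr_ge0.
by rewrite mulf_eq0 subr_eq0 => /orP[/eqP //|/eqP fxe]; move: (fe' x); rewrite fxe lexx.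
Qed.

(** * Schedules and digit expansions *)

Lemma monotone_schedule (n N : nat) (l : nat -> nat) :
  (\sum_(i < N) l i <= n)%N ->
  exists q : 'I_n -> nat, (forall t t' : 'I_n, (t <= t')%N -> (q t <= q t')%N) /\
    (forall i, (i < N)%N -> #|[set t | q t == i]| = l i).
Proof.
move=> ln; pose s0 := flatten [seq nseq (l i) i | i <- iota 0 N].
have cs0 (a : pred nat) : count a s0 = (\sum_(i < N) a i * l i)%N.
  rewrite count_flatten -!map_comp sumnE big_map -{1}[N]subn0 big_mkord.
  by apply: eq_bigr => i _; rewrite /= count_nseq.
have ss0 : size s0 = (\sum_(i < N) l i)%N.
  by rewrite -(count_predT s0) cs0; apply: eq_bigr => i _; rewrite mul1n.
(* Uses left over after all slots are filled get the number [N], past every slot. *)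
pose s := sort leq (s0 ++ nseq (n - size s0) N).
have ss : size s = n by rewrite size_sort size_cat size_nseq subnKC // ss0.
exists (fun t => nth 0%N s t); split => [t t' tt'|i iN].
  have ss' : sorted leq s by apply: sort_sorted; exact: leq_total.
  apply: (sorted_leq_nth leq_trans leqnn 0%N ss') => //; by rewrite inE ss.
rewrite -sum1_card.
transitivity (count_mem i s).
  rewrite -sum1_count (big_nth 0%N) big_mkord ss.
  by apply: eq_bigl => t; rewrite !inE.
rewrite /s (permP (permEl (perm_sort _ _))) count_cat count_nseq cs0 /=.
rewrite [_ == i]eq_sym (ltn_eqF iN) mul0n addn0 (bigD1 (Ordinal iN)) //= eqxx mul1n.
rewrite big1 ?addn0 // => j; rewrite -val_eqE /= => /negbTE ji.
by rewrite ji mul0n.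
Qed.

(** Any injection of the messages into [D]-tuples will do; positions from [D] on are padded with
    [ord0]. *)
Lemma digit_expansion (M K D : nat) : (M <= K.+1 ^ D)%N ->
  exists d : 'I_M -> nat -> 'I_K.+1,
    (forall w i, (D <= i)%N -> d w i = ord0) /\
    (forall w w', (forall i, (i < D)%N -> d w i = d w' i) -> w = w').
Proof.
move=> MK; have card : (M <= #|{ffun 'I_D -> 'I_K.+1}|)%N by rewrite card_ffun !card_ord.
pose f w := enum_val (widen_ord card w).
exists (fun w i => oapp (f w) ord0 (insub i)); split => [w i Di|w w' ww'].
  by rewrite insubF // ltnNge Di.
have : f w = f w'.
  by apply/ffunP => i; have := ww' i (ltn_ord i); rewrite (valK i).
by move=> /enum_val_inj/(congr1 val) /= ?; apply: val_inj.
Qed.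

(** * The block-Markov code *)

Section Scheme.
Variables (R : realType) (m : nat) (X Y : 'I_m.+2 -> finType).
Variables (n Ma Mb D : nat) (q : 'I_n -> nat).
Hypothesis q_mono : forall t t' : 'I_n, (t <= t')%N -> (q t <= q t')%N.
Variables (A B : finType) (a0 : A) (b0 : B) (wa0 : 'I_Ma) (wb0 : 'I_Mb).
Variables (da : 'I_Ma -> nat -> A) (db : 'I_Mb -> nat -> B).
Hypothesis da_out : forall w i, (D <= i)%N -> da w i = a0.
Hypothesis db_out : forall w i, (D <= i)%N -> db w i = b0.
Hypothesis da_inj : forall w w', (forall i, (i < D)%N -> da w i = da w' i) -> w = w'.
Hypothesis db_inj : forall w w', (forall i, (i < D)%N -> db w i = db w' i) -> w = w'.

(** [q t] is the slot of use [t]. Slots are numbered block after block and by phase within a block,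
    so quotient and remainder by [m + 2] give the block and the phase. *)
Definition phase t : 'I_m.+2 := Ordinal (ltn_pmod (q t) (ltn0Sn m.+1)).
Definition sender t : 'I_m.+2 := tx (phase t).
Definition block t : nat := (q t %/ m.+2)%N.

(* [a0], [b0] fill in for digits that do not exist, in particular while
   [block t < sender t]. *)
Definition cindex (t : 'I_n) (w : 'I_Ma * 'I_Mb) : A * B :=
  (if (sender t <= block t)%N then da w.1 (block t - sender t) else a0,
   db w.2 (block t)).

(** The uses from which node [k] learns digit [i] of the message of [a]: node [j < k] sends that
    digit in block [i + j]. *)
Definition uses_a (k : 'I_m.+2) (i : nat) : {set 'I_n} :=
  [set t | (sender t < k)%N && (block t == i + sender t)%N].
Definition uses_b (k : 'I_m.+2) (i : nat) : {set 'I_n} :=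
  [set t | (k < sender t)%N && (block t == i)].

Variable rho : forall p k : 'I_m.+2, X (tx p) -> Y k -> R.
Variables Ga Gb : R.
Variable F : forall t, A * B -> X (sender t).

(** [rho] will be instantiated by the likelihood ratio [lratio]; in this section it is arbitrary. *)
Definition score (T : {set 'I_n}) (k : 'I_m.+2) (c : 'I_n -> A * B)
    (y : hist Y n) : R :=
  \prod_(t in T) @rho (phase t) k (F t (c t)) (y t k).

(** A node in block [s] searches for a whole message pair [w'], although the tests only concern
    digits it can have heard. The last uses of [uses_a k i] lie in block [i + k - 1], before [s];
    [uses_b k i] may lie in block [s] itself, where the nodes beyond [k] transmit before [k]. *)
Definition passes (k : 'I_m.+2) (s : nat) (w w' : 'I_Ma * 'I_Mb) (y : hist Y n) : bool :=
  [&& (k == node_a m) ==> (w'.1 == w.1),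
      (k == node_b m) ==> (w'.2 == w.2),
      [forall i : 'I_D, (0 < k)%N && (i + k <= s)%N ==>
         (Ga <= score (uses_a k i) k (cindex^~ w') y)]
    & [forall i : 'I_D, (k < m.+1)%N && (i <= s)%N ==>
         (Gb <= score (uses_b k i) k (cindex^~ w') y)]].

Definition estimate k s w y : option ('I_Ma * 'I_Mb) :=
  [pick w' | passes k s w w' y].

(** [passes] consults only the message owned by node [k], so [wa0] and [wb0] can stand for the
    unknown one. The final values of [s] make all [D] digits testable: [i <= D] at [a], and
    [i + (m + 1) <= D + m + 1] at [b]. *)
Definition df_code : Defs.code X Y n Ma Mb :=
  Code (lab := phase)
    (fun t wa wb y =>
       F t (oapp (cindex t) (a0, b0) (estimate (sender t) (block t) (wa, wb) y)))
    (fun wa y => oapp snd wb0 (estimate (node_a m) D (wa, wb0) y))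
    (fun wb y => oapp fst wa0 (estimate (node_b m) (D + m.+1) (wa0, wb) y)).

(** Competitors differ from the truth in the tested digit only, so a union bound runs over one digit
    alphabet rather than over all messages. *)
Definition good_a k (i : nat) (w : 'I_Ma * 'I_Mb) (y : hist Y n) : bool :=
  (Ga <= score (uses_a k i) k (cindex^~ w) y) &&
  [forall u : A, (u != da w.1 i) ==>
     (score (uses_a k i) k (fun t => (u, (cindex t w).2)) y < Ga)].
Definition good_b k (i : nat) (w : 'I_Ma * 'I_Mb) (y : hist Y n) : bool :=
  (Gb <= score (uses_b k i) k (cindex^~ w) y) &&
  [forall u : B, (u != db w.2 i) ==>
     (score (uses_b k i) k (fun t => ((cindex t w).1, u)) y < Gb)].
Definition good (w : 'I_Ma * 'I_Mb) (y : hist Y n) : bool :=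
  [forall k : 'I_m.+2, forall i : 'I_D,
     ((0 < k)%N ==> good_a k i w y) && ((k < m.+1)%N ==> good_b k i w y)].

(** * Correct decoding on the good event *)

Lemma sender_val t : sender t = (m.+1 - q t %% m.+2)%N :> nat.
Proof. by rewrite /sender /tx /= subSS. Qed.

Lemma passes_true k s w y : good w y -> passes k s w w y.
Proof.
move=> /'forall_forallP g; rewrite /passes !eqxx !implybT /=.
apply/andP; split; apply/forallP => i; apply/implyP => /andP[kk _].
  by have /andP[/implyP/(_ kk)/andP[]] := g k i.
by have /andP[_ /implyP/(_ kk)/andP[]] := g k i.
Qed.

Lemma passes_mono k s s' w w' y : (s' <= s)%N -> passes k s w w' y -> passes k s' w w' y.
Proof.
move=> ss; rewrite /passes => /and4P[-> -> /forallP ha /forallP hb] /=; apply/andP; split.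
  apply/forallP => i; apply/implyP => /andP[k0 iks].
  by have /implyP := ha i; apply; rewrite k0 (leq_trans iks).
apply/forallP => i; apply/implyP => /andP[k0 iks].
by have /implyP := hb i; apply; rewrite k0 (leq_trans iks).
Qed.

Lemma eq_score (T : {set 'I_n}) k c c' y : {in T, c =1 c'} -> score T k c y = score T k c' y.
Proof. by move=> cc'; apply: eq_bigr => t /cc' ->. Qed.

(** Strong induction on the block [s]. When digit [i] of one message is tested, the digits of the
    other one mixed into those codewords are already correct: for [uses_a] they have number
    [i + j < i + k <= s], and for [uses_b] they have number [i - j] with [j > k], so
    [i - j + k < s]. The candidate then differs from the truth in one digit at most, and [good]
    excludes a difference. *)
Lemma passes_digits w y k s w' : good w y -> passes k s w w' y ->
  (forall i, (i + k <= s)%N -> da w'.1 i = da w.1 i) /\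
  (forall i, (i <= s)%N -> db w'.2 i = db w.2 i).
Proof.
move=> /'forall_forallP g; elim/ltn_ind: s => s IH ps.
have IHa i : (i + k < s)%N -> da w'.1 i = da w.1 i.
  by move=> iks; have [|h _] := IH _ iks; [exact: passes_mono (ltnW iks) ps | exact: h].
have IHb i : (i < s)%N -> db w'.2 i = db w.2 i.
  by move=> iks; have [|_ h] := IH _ iks; [exact: passes_mono (ltnW iks) ps | exact: h].
have /and4P[ownA ownB /forallP ha /forallP hb] := ps.
split=> i iks.
  have [iD|Di] := ltnP i D; last by rewrite !da_out.
  have [k0|k0] := posnP k.
    by move/implyP: ownA => /(_ _)/eqP-> //; apply/eqP/val_inj.
  have /andP[/implyP/(_ k0)/andP[_ /forallP bad] _] := g k (Ordinal iD).
  apply/eqP; apply: contraT => ne; have /implyP/(_ ne) := bad (da w'.1 i).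
  have /implyP := ha (Ordinal iD); rewrite k0 iks => /(_ isT) /=.
  rewrite (@eq_score _ _ _ (fun t => (da w'.1 i, (cindex t w).2))).
    by rewrite leNgt => /negbTE ->.
  move=> t; rewrite inE => /andP[tk /eqP bt]; rewrite /cindex bt leq_addl addnK.
  by congr (_, _); apply: IHb; apply: leq_trans iks; rewrite ltn_add2l.
have [iD|Di] := ltnP i D; last by rewrite !db_out.
have [km|km] := ltnP k m.+1; last first.
  move/implyP: ownB => /(_ _)/eqP-> //; apply/eqP/val_inj/eqP.
  by rewrite eqn_leq km -ltnS ltn_ord.
have /andP[_ /implyP/(_ km)/andP[_ /forallP bad]] := g k (Ordinal iD).
apply/eqP; apply: contraT => ne; have /implyP/(_ ne) := bad (db w'.2 i).
have /implyP := hb (Ordinal iD); rewrite km iks => /(_ isT) /=.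
rewrite (@eq_score _ _ _ (fun t => ((cindex t w).1, db w'.2 i))).
  by rewrite leNgt => /negbTE ->.
move=> t; rewrite inE => /andP[tk /eqP bt]; rewrite /cindex bt /=.
congr (_, _); case: ifP => // ji; apply: IHa.
by apply: leq_trans iks; rewrite -[ltnRHS](subnK ji) ltn_add2l.
Qed.

Lemma cindex_passes t w w' y : good w y ->
  passes (sender t) (block t) w w' y -> cindex t w' = cindex t w.
Proof.
move=> g p; have [ha hb] := passes_digits g p.
rewrite /cindex hb //; case: ifP => // jb; by rewrite ha // subnK.
Qed.

(** The pair picked need not be [w], but it has the same codeword index at this use. *)
Lemma enc_good t w y : good w y -> enc df_code t w.1 w.2 y = F t (cindex t w).
Proof.
move=> g; rewrite /= -surjective_pairing /estimate.
case: pickP => [w' /= /(cindex_passes g) -> //|/(_ w)].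
by rewrite passes_true.
Qed.

Lemma passes_own_a s w v w' y : v.1 = w.1 ->
  passes (node_a m) s v w' y = passes (node_a m) s w w' y.
Proof. by move=> vw; rewrite /passes vw. Qed.

Lemma passes_own_b s w v w' y : v.2 = w.2 ->
  passes (node_b m) s v w' y = passes (node_b m) s w w' y.
Proof. by move=> vw; rewrite /passes vw. Qed.

Lemma dec_a_good w y : good w y -> dec_a df_code w.1 y = w.2.
Proof.
move=> g; rewrite /= /estimate.
case: pickP => [w' /=|/(_ w)]; rewrite (@passes_own_a _ w) ?passes_true // => p.
by have [_ h] := passes_digits g p; apply: db_inj => i iD; rewrite h // ltnW.
Qed.

Lemma dec_b_good w y : good w y -> dec_b df_code w.2 y = w.1.
Proof.
move=> g; rewrite /= /estimate.
case: pickP => [w' /=|/(_ w)]; rewrite (@passes_own_b _ w) ?passes_true // => p.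
have [h _] := passes_digits g p; apply: da_inj => i iD; rewrite h //.
by rewrite leq_add2r ltnW.
Qed.

(** * Causality of the code *)

Lemma eq_score_obs (T : {set 'I_n}) (k : 'I_m.+2) c (y y' : hist Y n) :
  {in T, forall t, y t k = y' t k} ->
  score T k c y = score T k c y'.
Proof. by move=> yy'; apply: eq_bigr => t /yy' ->. Qed.

(** The tests of node [k] in block [s] read only its own outputs from slots preceding its own. *)
Lemma eq_passes k s (v v' w' : 'I_Ma * 'I_Mb) (y y' : hist Y n) :
  (k = node_a m -> v.1 = v'.1) -> (k = node_b m -> v.2 = v'.2) ->
  (forall t, sender t != k -> (block t < s)%N || (block t == s) && (k < sender t)%N ->
     y t k = y' t k) ->
  passes k s v w' y = passes k s v' w' y'.
Proof.
move=> va vb yy'; rewrite /passes; congr [&& _, _, _ & _].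
- by case: eqP => // /va ->.
- by case: eqP => // /vb ->.
- apply: eq_forallb => i; case: (boolP (_ && _)) => //= /andP[k0 iks].
  rewrite (@eq_score_obs _ _ _ y y') // => t; rewrite inE => /andP[tk /eqP bt].
  apply: yy'; first by rewrite -val_eqE ltn_eqF.
  by rewrite bt (leq_trans _ iks) // ltn_add2l.
- apply: eq_forallb => i; case: (boolP (_ && _)) => //= /andP[k0 iks].
  rewrite (@eq_score_obs _ _ _ y y') // => t; rewrite inE => /andP[tk /eqP bt].
  apply: yy'; first by rewrite -val_eqE gtn_eqF.
  by rewrite bt tk andbT orbC -leq_eqVlt.
Qed.

(** Phases run from [b] to [a], so within a block the larger sender index comes first; monotonicity
    of [q] turns the order of slots into the order of uses. *)
Lemma before_slot t t' : (block t' < block t)%N ||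
  (block t' == block t) && (sender t < sender t')%N -> (t' < t)%N.
Proof.
move=> h; rewrite ltnNge; apply/negP => /q_mono qq; move: h.
rewrite /block !sender_val; have := divn_eq (q t) m.+2; have := divn_eq (q t') m.+2.
have := ltn_pmod (q t) (ltn0Sn m.+1); have := ltn_pmod (q t') (ltn0Sn m.+1).
have := leq_div2r m.+2 qq.
set b := (q t %/ _)%N; set b' := (q t' %/ _)%N => bb r1 r2 e1 e2.
rewrite ltnNge bb /= => /andP[/eqP be].
rewrite e1 e2 be leq_add2l in qq.
by rewrite ltnNge leq_sub2l.
Qed.

Lemma df_code_valid : valid_code df_code.
Proof.
split.
- move=> t wa wa' wb wb' y y' ha hb past /=; congr (F t (oapp _ _ _)).
  apply: eq_pick => w'; apply: eq_passes => // t' st' /before_slot lt.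
  exact: past.
- move=> wa y y' same /=; congr (oapp _ _ _); apply: eq_pick => w'.
  by apply: eq_passes => // t' st' _; exact: same.
- move=> wb y y' same /=; congr (oapp _ _ _); apply: eq_pick => w'.
  by apply: eq_passes => // t' st' _; exact: same.
Qed.

End Scheme.

(** * Random codebooks *)

(** Union bound on indicators, ready for use under an expectation. *)
Lemma natr_negb_forall (R : numDomainType) (I : finType) (a : pred I) :
  (~~ [forall i, a i])%:R <= \sum_i (~~ a i)%:R :> R.
Proof.
case: (boolP [forall i, a i]) => [_|]; first by rewrite sumr_ge0.
rewrite negb_forall => /existsP[i ai]; rewrite (bigD1 i) //= ai lerDl.
by rewrite sumr_ge0.
Qed.

Lemma natr_negb_and (R : numDomainType) (a b : bool) :
  (~~ (a && b))%:R <= (~~ a)%:R + (~~ b)%:R :> R.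
Proof. by case: a b => [] [] //=; rewrite ?addr0 ?add0r // lerDl. Qed.

Section LikelihoodRatio.
Variables (R : realType) (m : nat) (X Y : 'I_m.+2 -> finType).
Variables (W : channel R X Y) (P : input_distrs R X).
Hypotheses (HW : stochastic W) (HP : forall p, is_distr (@P p)).
Implicit Types p k : 'I_m.+2.

Definition recv p k (x : X (tx p)) (yk : Y k) : R :=
  \sum_(o : outs Y | o k == yk) W x o.
Definition recv_law p k (yk : Y k) : R := \sum_x @P p x * @recv p k x yk.
(* [dP(y|x)/dP(y)], with the junk value 0 when [yk] has probability 0 *)
Definition lratio p k (x : X (tx p)) (yk : Y k) : R :=
  @recv p k x yk / @recv_law p k yk.

(* moment generating function of minus the information density *)
Definition mgf p k (s : R) : R :=
  \sum_x @P p x * \sum_(o : outs Y) W x o * expR (- s * ln (@lratio p k x (o k))).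

Lemma W_ge0 p x o : 0 <= @W p x o. Proof. by case: HW. Qed.
Lemma W_sum1 p x : \sum_o @W p x o = 1. Proof. by case: HW. Qed.
Lemma P_ge0 p x : 0 <= @P p x. Proof. by case: (HP p). Qed.
Lemma P_sum1 p : \sum_x @P p x = 1. Proof. by case: (HP p). Qed.

Lemma recv_ge0 p k x yk : 0 <= @recv p k x yk.
Proof. by apply: sumr_ge0 => o _; exact: W_ge0. Qed.

Lemma recv_law_ge0 p k yk : 0 <= @recv_law p k yk.
Proof. by apply: sumr_ge0 => x _; rewrite mulr_ge0 ?P_ge0 ?recv_ge0. Qed.

Lemma lratio_ge0 p k x yk : 0 <= @lratio p k x yk.
Proof. by rewrite divr_ge0 ?recv_ge0 ?recv_law_ge0. Qed.

Lemma recv_law_gt0 p k x (yk : Y k) : 0 < @P p x -> 0 < @recv p k x yk ->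
  0 < recv_law p yk.
Proof.
move=> Px rx; rewrite /recv_law (bigD1 x) //= ltr_wpDr ?mulr_gt0 //.
by apply: sumr_ge0 => x' _; rewrite mulr_ge0 ?P_ge0 ?recv_ge0.
Qed.

Lemma lratio_gt0 p k x (o : outs Y) : 0 < @P p x -> 0 < W x o ->
  0 < @lratio p k x (o k).
Proof.
move=> Px Wo.
have rx : 0 < recv x (o k).
  rewrite /recv (bigD1 o) //= ltr_wpDr //.
  by apply: sumr_ge0 => o' _; exact: W_ge0.
by rewrite divr_gt0 // (recv_law_gt0 Px).
Qed.

Lemma sum_recv p k x (f : Y k -> R) :
  \sum_(o : outs Y) W x o * f (o k) = \sum_(yk : Y k) @recv p k x yk * f yk.
Proof.
rewrite (partition_big (fun o : outs Y => o k) xpredT) //=.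
apply: eq_bigr => yk _; rewrite /recv mulr_suml.
by apply: eq_bigr => o /eqP ->.
Qed.

(** Averaged over an input independent of the output, the ratio becomes [recv_law / recv_law], which
    is 1, or 0 where [recv_law] vanishes. *)
Lemma sum_lratio_le1 p k :
  \sum_(o : outs Y) (\sum_x @P p x * @W p x o) * (\sum_x @P p x * @lratio p k x (o k)) <= 1.
Proof.
apply: (@le_trans _ _ (\sum_(o : outs Y) \sum_x @P p x * @W p x o)).
  apply: ler_sum => o _; rewrite ler_piMr //.
    by apply: sumr_ge0 => x _; rewrite mulr_ge0 ?P_ge0 ?W_ge0.
  under eq_bigr do rewrite mulrA; rewrite -mulr_suml -/(recv_law p (o k)).
  by have [->|/divff ->//] := eqVneq (recv_law p (o k)) 0; rewrite invr0 mulr0.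
rewrite exchange_big /= -[leRHS](P_sum1 p) ler_sum // => x _.
by rewrite -mulr_sumr W_sum1 mulr1.
Qed.

(** * Expectations over a random codebook *)

Section Codebook.
Variables (n : nat) (q : 'I_n -> nat) (C : finType).

Definition codebook := fprod (fun t => {ffun C -> X (sender m q t)} : finType).

Definition cbprob (F : codebook) : R :=
  \prod_t \prod_c @P (phase m q t) (F t c).

Definition chprob (c : 'I_n -> C) (F : codebook) (y : hist Y n) : R :=
  \prod_t @W (phase m q t) (F t (c t)) (y t).

(** The genie-aided law: use [t] carries index [c t] whatever was received, so given the codebook
    the outputs are independent. *)
Definition expect (c : 'I_n -> C) (f : codebook -> hist Y n -> R) : R :=
  \sum_F cbprob F * \sum_(y : hist Y n) chprob c F y * f F y.

Lemma cbprob_ge0 F : 0 <= cbprob F.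
Proof. by do 2!apply: prodr_ge0 => ? _; exact: P_ge0. Qed.

Lemma chprob_ge0 c F y : 0 <= chprob c F y.
Proof. by apply: prodr_ge0 => ? _; exact: W_ge0. Qed.

Lemma cbprob_sum1 : \sum_F cbprob F = 1.
Proof.
rewrite -(prod_sum_fprod (fun t (f : {ffun C -> X (sender m q t)}) =>
  \prod_c @P (phase m q t) (f c))) big1 // => t _.
by rewrite -(bigA_distr_bigA (fun=> @P (phase m q t))) big1 // => c _; exact: P_sum1.
Qed.

(** Comparison off null sets only, because logarithms of likelihood ratios are meaningful only
    there. *)
Lemma le_expect c f g :
  (forall F y, cbprob F != 0 -> chprob c F y != 0 -> f F y <= g F y) ->
  expect c f <= expect c g.
Proof.
move=> fg; apply: ler_sum => F _.
have [->|F0] := eqVneq (cbprob F) 0; first by rewrite !mul0r.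
rewrite ler_wpM2l ?cbprob_ge0 //; apply: ler_sum => y _.
have [->|y0] := eqVneq (chprob c F y) 0; first by rewrite !mul0r.
by rewrite ler_wpM2l ?chprob_ge0 // fg.
Qed.

Lemma expectD c f g :
  expect c (fun F y => f F y + g F y) = expect c f + expect c g.
Proof.
rewrite /expect -big_split; apply: eq_bigr => F _ /=.
rewrite -mulrDr -big_split; congr (_ * _).
by apply: eq_bigr => y _; rewrite mulrDr.
Qed.

Lemma expectZ c a f : expect c (fun F y => a * f F y) = a * expect c f.
Proof.
rewrite /expect mulr_sumr; apply: eq_bigr => F _.
rewrite mulrCA; congr (_ * _); rewrite mulr_sumr.
by apply: eq_bigr => y _; rewrite mulrCA.
Qed.

Lemma expect_sum c (I : finType) (Q : pred I) f :
  expect c (fun F y => \sum_(i | Q i) f i F y) = \sum_(i | Q i) expect c (f i).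
Proof.
rewrite /expect exchange_big /=; apply: eq_bigr => F _.
rewrite -mulr_sumr; congr (_ * _); rewrite exchange_big /=; apply: eq_bigr => y _.
by rewrite mulr_sumr.
Qed.

Lemma expect_prod (c c' : 'I_n -> C)
    (g : forall t, X (sender m q t) -> outs Y -> R) :
  expect c (fun F y => \prod_t g t (F t (c' t)) (y t)) =
  \prod_t \sum_(f : {ffun C -> X (sender m q t)}) \sum_(o : outs Y)
     (\prod_d @P (phase m q t) (f d)) * (@W (phase m q t) (f (c t)) o * g t (f (c' t)) o).
Proof.
rewrite -(sum_prod_codebook (fun t f o =>
  (\prod_d @P (phase m q t) (f d)) * (@W (phase m q t) (f (c t)) o * g t (f (c' t)) o))).
apply: eq_bigr => F _; rewrite mulr_sumr; apply: eq_bigr => y _.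
by rewrite !big_split.
Qed.

Lemma expect_miss (T : {set 'I_n}) (k : 'I_m.+2) (c : 'I_n -> C) (s : R) :
  expect c (fun F y =>
    \prod_(t in T) expR (- s * ln (@lratio (phase m q t) k (F t (c t)) (y t k))))
  = \prod_(t in T) mgf (phase m q t) k s.
Proof.
pose g t (x : X (sender m q t)) (o : outs Y) : R :=
  if t \in T then expR (- s * ln (@lratio (phase m q t) k x (o k))) else 1.
transitivity (expect c (fun F y => \prod_t g t (F t (c t)) (y t))).
  by congr expect; apply: funext => F; apply: funext => y; rewrite -big_mkcond.
rewrite expect_prod [RHS]big_mkcond; apply: eq_bigr => t _.
under eq_bigr do rewrite -mulr_sumr.
rewrite (iid_marginal (P_sum1 _) (c t)
  (fun x => \sum_(o : outs Y) @W (phase m q t) x o * g t x o)) /g.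
case: ifP => // _; rewrite -[RHS](P_sum1 (phase m q t)); apply: eq_bigr => x _.
by under eq_bigr do rewrite mulr1; rewrite W_sum1 mulr1.
Qed.

(** At a use in [T] the tested codeword is independent of the one sent, hence of the output, and
    [sum_lratio_le1] applies; any other use contributes a factor 1. *)
Lemma expect_false_le1 (T : {set 'I_n}) (k : 'I_m.+2) (c c' : 'I_n -> C) :
  {in T, forall t, c t != c' t} ->
  expect c (fun F y => \prod_(t in T) @lratio (phase m q t) k (F t (c' t)) (y t k)) <= 1.
Proof.
move=> cc'.
pose g t (x : X (sender m q t)) (o : outs Y) : R :=
  if t \in T then @lratio (phase m q t) k x (o k) else 1.
rewrite [leLHS](_ : _ = expect c (fun F y => \prod_t g t (F t (c' t)) (y t))); last first.
  by congr expect; apply: funext => F; apply: funext => y; rewrite -big_mkcond.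
rewrite expect_prod; apply: prodr_ile1 => t _; rewrite /g.
have [tT|tT] := boolP (t \in T); last first.
  under eq_bigr do rewrite -mulr_sumr.
  rewrite (iid_marginal (P_sum1 _) (c t)
    (fun x => \sum_(o : outs Y) @W (phase m q t) x o * 1)).
  rewrite (eq_bigr (@P (phase m q t))) ?P_sum1 ?ler01 ?lexx // => x _.
  by under eq_bigr do rewrite mulr1; rewrite W_sum1 mulr1.
rewrite exchange_big /=.
under eq_bigr => o _ do rewrite (iid_marginal2 (P_sum1 _)
  (fun x => @W (phase m q t) x o) (fun x => @lratio (phase m q t) k x (o k)) (cc' t tT)).
rewrite sum_lratio_le1 andbT; apply: sumr_ge0 => o _.
by rewrite mulr_ge0 // sumr_ge0 // => x _; rewrite mulr_ge0 ?P_ge0 ?W_ge0 ?lratio_ge0.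
Qed.

(** Chernoff bound: if the product of ratios is below [expR gam], then [expR (s * gam)] times its
    power [- s] is at least 1. *)
Lemma le_expect_miss (T : {set 'I_n}) (k : 'I_m.+2) (c : 'I_n -> C) (s gam : R) :
  0 <= s ->
  expect c (fun F y => (~~ (expR gam <=
     \prod_(t in T) @lratio (phase m q t) k (F t (c t)) (y t k)))%:R)
  <= expR (s * gam) * \prod_(t in T) mgf (phase m q t) k s.
Proof.
move=> s0; rewrite -(expect_miss T k c s) -expectZ; apply: le_expect => F y F0 y0.
have Pgt t d : 0 < @P (phase m q t) (F t d).
  rewrite lt_neqAle P_ge0 andbT eq_sym; apply: contraNneq F0 => Pt.
  by rewrite /cbprob (bigD1 t) //= (bigD1 d) //= Pt !mul0r.
have Wgt t : 0 < @W (phase m q t) (F t (c t)) (y t).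
  rewrite lt_neqAle W_ge0 andbT eq_sym; apply: contraNneq y0 => Wt.
  by rewrite /chprob (bigD1 t) //= Wt !mul0r.
have Lgt t : 0 < @lratio (phase m q t) k (F t (c t)) (y t k) by exact: lratio_gt0.
have [_|lt] /= := lerP (expR gam) _.
  by rewrite mulr_ge0 ?expR_ge0 // prodr_ge0 // => t _; exact: expR_ge0.
rewrite -expR_sum -expRD -[leLHS](@expR0 R) ler_expR -mulr_sumr mulNr -mulrBr.
rewrite mulr_ge0 // subr_ge0 ltW // -ltr_expR; apply: le_lt_trans lt.
by rewrite expR_sum le_eqVlt; apply/orP; left; apply/eqP/eq_bigr => t _; rewrite lnK // posrE.
Qed.

(** Markov's inequality applied to [expect_false_le1]. *)
Lemma le_expect_false (T : {set 'I_n}) (k : 'I_m.+2) (c c' : 'I_n -> C) (G : R) :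
  0 < G -> {in T, forall t, c t != c' t} ->
  expect c (fun F y =>
    (G <= \prod_(t in T) @lratio (phase m q t) k (F t (c' t)) (y t k))%R%:R) <= G^-1.
Proof.
move=> G0 cc'; apply: (@le_trans _ _ (expect c (fun F y => G^-1 *
    \prod_(t in T) @lratio (phase m q t) k (F t (c' t)) (y t k)))).
  apply: le_expect => F y _ _; have [h|_] /= := lerP G _.
    by rewrite mulrC ler_pdivlMr // mul1r.
  by rewrite mulr_ge0 ?invr_ge0 ?(ltW G0) // prodr_ge0 // => t _; exact: lratio_ge0.
rewrite expectZ -[leRHS]mulr1 ler_wpM2l ?invr_ge0 ?(ltW G0) //.
exact: expect_false_le1.
Qed.

End Codebook.
End LikelihoodRatio.

(** * Average error of the code *)

Section AverageError.
Variables (R : realType) (m : nat) (X Y : 'I_m.+2 -> finType).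
Variables (W : channel R X Y) (P : input_distrs R X).
Hypotheses (HW : stochastic W) (HP : forall p, is_distr (@P p)).

Notation scoreL F := (score (@lratio R m X Y W P) (fun t c => F t c)).

(** One threshold test: [cand u] is the index sequence with the tested digit replaced by [u], and
    [u0] is the true digit. The two summands bound a miss and a false acceptance. *)
Lemma expect_step (n : nat) (q : 'I_n -> nat) (A B U : finType) (T : {set 'I_n})
    (k : 'I_m.+2) (c : 'I_n -> A * B) (cand : U -> 'I_n -> A * B) (u0 : U) (s gam : R) :
  0 <= s -> (forall u, u != u0 -> {in T, forall t, c t != cand u t}) ->
  expect W P c (fun (F : codebook X q (A * B)%type) y =>
     (~~ ((expR gam <= scoreL F T k c y) && [forall u, (u != u0) ==>
            (scoreL F T k (cand u) y < expR gam)]))%:R)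
  <= expR (s * gam) * \prod_(t in T) mgf W P (phase m q t) k s
     + #|U|%:R * expR (- gam).
Proof.
move=> s0 cc; apply: (@le_trans _ _ (expect W P c
    (fun (F : codebook X q (A * B)%type) y =>
     (~~ (expR gam <= scoreL F T k c y))%:R +
     \sum_(u | u != u0) (expR gam <= scoreL F T k (cand u) y)%R%:R))).
  apply: le_expect => // F y _ _; apply: le_trans (natr_negb_and _ _ _) _.
  rewrite lerD2l; apply: le_trans (natr_negb_forall _ _) _.
  rewrite [leRHS]big_mkcond ler_sum // => u _; case: (u != u0) => //=.
  by rewrite -leNgt.
rewrite expectD expect_sum lerD //; first exact: le_expect_miss.
apply: (@le_trans _ _ (\sum_(u : U | u != u0) expR (- gam))).
  apply: ler_sum => u /cc cu; rewrite expRN.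
  exact: (@le_expect_false _ _ _ _ _ _ HW HP n q _ T k c (cand u) _ (expR_gt0 gam) cu).
rewrite sumr_const -[leLHS]mulr_natl ler_wpM2r ?expR_ge0 // ler_nat.
exact: max_card.
Qed.

Variables (n Ma Mb D : nat) (q : 'I_n -> nat).
Hypothesis q_mono : forall t t' : 'I_n, (t <= t')%N -> (q t <= q t')%N.
Variables (A B : finType) (a0 : A) (b0 : B) (wa0 : 'I_Ma) (wb0 : 'I_Mb).
Variables (da : 'I_Ma -> nat -> A) (db : 'I_Mb -> nat -> B).
Hypothesis da_out : forall w i, (D <= i)%N -> da w i = a0.
Hypothesis db_out : forall w i, (D <= i)%N -> db w i = b0.
Hypothesis da_inj : forall w w', (forall i, (i < D)%N -> da w i = da w' i) -> w = w'.
Hypothesis db_inj : forall w w', (forall i, (i < D)%N -> db w i = db w' i) -> w = w'.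
Variables (ga gb s : R).
Hypothesis s0 : 0 <= s.

Let C : finType := (A * B)%type.
Let goodL (F : codebook X q C) :=
  good D a0 da db (@lratio R m X Y W P) (expR ga) (expR gb) (fun t c => F t c).
Let codeL (F : codebook X q C) :=
  df_code D a0 b0 wa0 wb0 da db (@lratio R m X Y W P) (expR ga) (expR gb)
    (fun t c => F t c).
Let cindexL (w : 'I_Ma * 'I_Mb) t := cindex m q a0 da db t w.

Definition step_error (gam : R) (U : finType) (T : {set 'I_n}) (k : 'I_m.+2) : R :=
  expR (s * gam) * \prod_(t in T) mgf W P (phase m q t) k s + #|U|%:R * expR (- gam).

Definition df_error : R := \sum_(k : 'I_m.+2) \sum_(i < D)
  ((0 < k)%N%:R * step_error ga A (uses_a q k i) k
   + (k < m.+1)%N%:R * step_error gb B (uses_b q k i) k).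

Lemma expect_bad w :
  expect W P (cindexL w) (fun F y => (~~ goodL F w y)%:R) <= df_error.
Proof.
pose na (k : 'I_m.+2) (i : 'I_D) F y : R := (~~ good_a a0 da db (@lratio R m X Y W P) (expR ga)
   (fun t c => (F : codebook X q C) t c) k i w y)%:R.
pose nb (k : 'I_m.+2) (i : 'I_D) F y : R := (~~ good_b a0 da db (@lratio R m X Y W P) (expR gb)
   (fun t c => (F : codebook X q C) t c) k i w y)%:R.
apply: (@le_trans _ _ (expect W P (cindexL w) (fun F y =>
    \sum_(k : 'I_m.+2) \sum_(i < D)
     ((0 < k)%N%:R * na k i F y + (k < m.+1)%N%:R * nb k i F y)))).
  apply: le_expect => // F y _ _; apply: le_trans (natr_negb_forall _ _) _.
  apply: ler_sum => k _; apply: le_trans (natr_negb_forall _ _) _.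
  apply: ler_sum => i _; apply: le_trans (natr_negb_and _ _ _) _.
  by rewrite lerD // negb_imply -mulnb natrM.
rewrite expect_sum ler_sum // => k _; rewrite expect_sum ler_sum // => i _.
rewrite expectD !expectZ lerD // ler_wpM2l //.
  apply: expect_step => // u ne t; rewrite inE => /andP[_ /eqP bt].
  rewrite /cindexL /cindex bt leq_addl addnK xpair_eqE negb_and eq_sym.
  by rewrite ne.
apply: (@expect_step n q A B B _ k _ (fun u t => ((cindex m q a0 da db t w).1, u))) => // u ne t.
rewrite inE => /andP[_ /eqP bt].
by rewrite /cindexL /cindex bt xpair_eqE negb_and [db _ _ == _]eq_sym ne orbT.
Qed.

(** Masses equal to 1 rule out empty alphabets; this supplies the placeholder of
    [causal_prod_sum1]. *)
Lemma outs_inhabited : inhabited (outs Y).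
Proof.
pose p : 'I_m.+2 := ord0; have [x _|X0] := pickP (@predT (X (tx p))); last first.
  have [_] := HP p; rewrite big_pred0 => [/esym/eqP|x]; first by rewrite oner_eq0.
  by have := X0 x.
have [z _|O0] := pickP (@predT (outs Y)); first by constructor; exact: z.
have [_ /(_ p x)] := HW; rewrite big_pred0 => [/esym/eqP|o]; first by rewrite oner_eq0.
by have := O0 o.
Qed.

(* Off the bad event the code coincides with the genie-aided one, in which all
   nodes transmit the true digits; both laws have total mass 1. *)
Lemma code_bad (F : codebook X q C) (w : 'I_Ma * 'I_Mb) (E : pred (hist Y n)) :
  (forall y, goodL F w y -> ~~ E y) ->
  \sum_(y | E y) \prod_t @W (lab (codeL F) t) (enc (codeL F) t w.1 w.2 y) (y t)
  <= \sum_(y : hist Y n) chprob W (cindexL w) F y * (~~ goodL F w y)%:R.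
Proof.
move=> gE; have [z0] := outs_inhabited.
pose pr y : R := \prod_t @W (lab (codeL F) t) (enc (codeL F) t w.1 w.2 y) (y t).
have pr0 y : 0 <= pr y by apply: prodr_ge0 => t _; exact: W_ge0.
have pr1 : \sum_y pr y = 1.
  rewrite /pr (causal_prod_sum1 (V := fun t y o =>
     @W (lab (codeL F) t) (enc (codeL F) t w.1 w.2 y) o)) // => [t y|t y y' yy' o].
    exact: W_sum1.
  have [val_enc _ _] := df_code_valid D q_mono a0 b0 wa0 wb0 da db
    (@lratio R m X Y W P) (expR ga) (expR gb) (fun t c => F t c).
  by congr (@W _ _ o); apply: val_enc => // t' t't _; rewrite yy'.
have ch1 : \sum_(y : hist Y n) chprob W (cindexL w) F y = 1.
  rewrite /chprob (causal_prod_sum1 (V := fun t _ o =>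
     @W (phase m q t) (F t (cindexL w t)) o)) // => t y.
  exact: W_sum1.
apply: (@le_trans _ _ (\sum_(y | ~~ goodL F w y) pr y)).
  rewrite [leLHS]big_mkcond [leRHS]big_mkcond ler_sum // => y _ /=.
  case: (boolP (goodL F w y)) => [/gE/negbTE->|_] //.
  by case: ifP => _; [exact: lexx | exact: pr0].
rewrite le_eqVlt; apply/orP; left; apply/eqP.
rewrite -[RHS](addrK (\sum_(y | goodL F w y) pr y)).
apply/eqP; rewrite eq_sym subr_eq; apply/eqP.
transitivity (1 : R); last first.
  by rewrite -pr1 (bigID (goodL F w)) /= addrC.
rewrite -[RHS]ch1 [X in _ + X]big_mkcond -big_split /=; apply: eq_bigr => y _.
case: (boolP (goodL F w y)) => [g|_] /=; last by rewrite mulr1 addr0.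
rewrite mulr0 add0r; apply: eq_bigr => t _.
by rewrite (enc_good wa0 wb0 da_out db_out).
Qed.

(** The same bad event dominates both decoding errors, so a single codebook with small average [bad]
    serves both directions. *)
Lemma df_code_exists : exists c : Defs.code X Y n Ma Mb,
  [/\ valid_code c, lab c = phase m q, err_a c W <= df_error & err_b c W <= df_error].
Proof.
pose N : R := (Ma%:R * Mb%:R)^-1.
have N0 : 0 <= N by rewrite invr_ge0 mulr_ge0.
have N1 : \sum_(wa : 'I_Ma) \sum_(wb : 'I_Mb) N = 1.
  rewrite !sumr_const !card_ord -[LHS]mulr_natl -[X in _ * X]mulr_natl mulrA.
  by rewrite divff // mulf_neq0 // pnatr_eq0 -lt0n; [case: Ma wa0 => [[]|] | case: Mb wb0 => [[]|]].
pose bad F w := \sum_(y : hist Y n) chprob W (cindexL w) F y * (~~ goodL F w y)%:R.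
pose avg F := \sum_(wa : 'I_Ma) \sum_(wb : 'I_Mb) N * bad F (wa, wb).
have [F avgF] : exists F, avg F <= df_error.
  apply: (le_weighted_avg (fun F => cbprob_ge0 HP F) (cbprob_sum1 HP q C)).
  rewrite (eq_bigr (fun F => \sum_(wa : 'I_Ma) \sum_(wb : 'I_Mb)
      N * (cbprob P F * bad F (wa, wb)))) => [|F _]; last first.
    rewrite mulr_sumr; apply: eq_bigr => wa _; rewrite mulr_sumr.
    by apply: eq_bigr => wb _; rewrite mulrCA.
  rewrite exchange_big /= -[leRHS]mul1r -N1 mulr_suml ler_sum // => wa _.
  rewrite exchange_big /= mulr_suml ler_sum // => wb _.
  by rewrite -mulr_sumr ler_wpM2l //; exact: expect_bad.
exists (codeL F); split => //.
- exact: df_code_valid.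
- apply: le_trans avgF; apply: ler_sum => wa _; apply: ler_sum => wb _.
  rewrite /jprob -mulr_sumr ler_wpM2l //.
  apply: (code_bad (w := (wa, wb))) => y g; rewrite negbK.
  by rewrite (dec_a_good wa0 wb0 da_out db_out db_inj g).
- apply: le_trans avgF; apply: ler_sum => wa _; apply: ler_sum => wb _.
  rewrite /jprob -mulr_sumr ler_wpM2l //.
  apply: (code_bad (w := (wa, wb))) => y g; rewrite negbK.
  by rewrite (dec_b_good wa0 wb0 da_out db_out da_inj g).
Qed.

End AverageError.

(** * Chernoff exponent *)

Lemma exp_decay_cvg0 (R : realType) (K x : R) : 0 < x ->
  ((fun n : nat => K * expR (- x) ^+ n) @ \oo --> (0 : R))%classic.
Proof.
move=> x0; apply: cvg_geometric.
by rewrite ger0_norm ?expR_ge0 // expR_lt1 oppr_lt0.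
Qed.

Lemma finite_pos_lower_bound (R : realFieldType) (I : finType) (Q : pred I) (f : I -> R) :
  (forall i, Q i -> 0 < f i) -> exists2 d, 0 < d & forall i, Q i -> d <= f i.
Proof.
move=> f0; pose S := \sum_(i | Q i) (f i)^-1.
have S0 : 0 <= S by apply: sumr_ge0 => i /f0/ltW; rewrite invr_ge0.
(* The summand 1 keeps the witness positive when [Q] is empty. *)
exists (1 + S)^-1 => [|i Qi]; first by rewrite invr_gt0; lra.
rewrite -[leRHS]invrK lef_pV2 ?posrE ?invr_gt0 ?f0 //; last by lra.
rewrite /S (bigD1 i) //= addrCA lerDl addr_ge0 //.
by apply: sumr_ge0 => j /andP[/f0/ltW]; rewrite invr_ge0.
Qed.

Lemma sum_modn (M b : nat) (f : nat -> nat) :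
  (\sum_(i < b * M.+1) f (i %% M.+1) = b * \sum_(p < M.+1) f p)%N.
Proof.
elim: b => [|b IH]; first by rewrite big_ord0.
rewrite mulSn big_split_ord /= mulSn; congr (_ + _)%N.
  by apply: eq_bigr => i _; rewrite modn_small.
by rewrite -IH; apply: eq_bigr => i _; rewrite modnDl.
Qed.

Section MgfBound.
Variables (R : realType) (m : nat) (X Y : 'I_m.+2 -> finType).
Variables (W : channel R X Y) (P : input_distrs R X).
Hypotheses (HW : stochastic W) (HP : forall p, is_distr (@P p)).

(** Cancelling [P x] turns [joint / (P x * py)] into the likelihood ratio; terms with [joint = 0]
    contribute nothing on either side. *)
Lemma mutinf_lratio (p k : 'I_m.+2) :
  mutinf W (@P p) k * ln 2 =
  \sum_x @P p x * \sum_(o : outs Y) @W p x o * ln (@lratio R m X Y W P p k x (o k)).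
Proof.
have ln2 : ln 2 != 0 :> R by rewrite gt_eqF // ln_gt0 // ltr1n.
rewrite /mutinf mulr_suml; apply: eq_bigr => x _.
rewrite (sum_recv W x (fun yk => ln (@lratio R m X Y W P p k x yk))).
rewrite mulr_suml mulr_sumr big_mkcond; apply: eq_bigr => yk _.
rewrite -/(@recv R m X Y W p k x yk).
rewrite (_ : \sum_x0 _ = @recv_law R m X Y W P p k yk) //.
case: ifPn => [|/negbNE/eqP j0]; last by rewrite mulrA j0 mul0r.
rewrite mulf_eq0 negb_or => /andP[Px _].
rewrite /log2 -!mulrA mulVf // mulr1; congr (_ * (_ * ln _)).
by rewrite /lratio invfM mulrCA mulVKf.
Qed.

Lemma lratio_bounded : exists2 L : R, 0 <= L &
  forall (p k : 'I_m.+2) x (yk : Y k), `|ln (@lratio R m X Y W P p k x yk)| <= L.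
Proof.
pose f (p k : 'I_m.+2) := \sum_x \sum_(yk : Y k) `|ln (@lratio R m X Y W P p k x yk)|.
have f0 p k : 0 <= f p k by apply: sumr_ge0 => x _; apply: sumr_ge0.
exists (\sum_p \sum_k f p k) => [|p k x yk].
  by apply: sumr_ge0 => p _; apply: sumr_ge0.
rewrite (bigD1 p) //= (bigD1 k) //= {1}/f (bigD1 x) //= (bigD1 yk) //= -!addrA lerDl.
rewrite !addr_ge0 ?sumr_ge0 // => *; by rewrite sumr_ge0.
Qed.

(** Second-order expansion, valid since [s * L <= 1/2]: the linear term is the mutual information,
    and [1 + x <= expR x] concludes. *)
Lemma mgf_le (L s : R) (p k : 'I_m.+2) : 0 <= L -> 0 <= s -> s * L <= 2^-1 ->
  (forall x (yk : Y k), `|ln (@lratio R m X Y W P p k x yk)| <= L) ->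
  mgf W P p k s <= expR (- s * (mutinf W (@P p) k * ln 2) + 2 * (s * L) ^+ 2).
Proof.
move=> L0 s0 sL lnL; apply: le_trans (expR_ge1Dx _).
pose l x (o : outs Y) := ln (@lratio R m X Y W P p k x (o k)).
apply: (@le_trans _ _ (\sum_x @P p x * \sum_(o : outs Y) @W p x o *
    (1 + 2 * (s * L) ^+ 2 + - s * l x o))).
  apply: ler_sum => x _; rewrite ler_wpM2l ?(P_ge0 HP) //.
  apply: ler_sum => o _; rewrite ler_wpM2l ?(W_ge0 HW) //.
  have := lnL x (o k); rewrite -/(l x o) ler_norml => /andP[l1 l2].
  apply: le_trans (expR_le_quadratic _) _; first by nra.
  (* The product of the two factors is [(s * L) ^+ 2 - (s * l x o) ^+ 2]. *)
  have a : 0 <= s * (L - l x o) by rewrite mulr_ge0 //; lra.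
  have b : 0 <= s * (L + l x o) by rewrite mulr_ge0 //; lra.
  by have := mulr_ge0 a b; lra.
rewrite le_eqVlt; apply/orP; left; apply/eqP.
rewrite mutinf_lratio addrCA addrC [- s * _]mulr_sumr.
transitivity (\sum_x (@P p x * (1 + 2 * (s * L) ^+ 2) +
   - s * (@P p x * \sum_(o : outs Y) @W p x o * l x o))).
  apply: eq_bigr => x _; under eq_bigr => o _ do rewrite mulrDr [_ * (- s * _)]mulrCA.
  rewrite big_split /= -mulr_suml (W_sum1 HW) mul1r mulrDr; congr (_ + _).
  by rewrite -mulr_sumr mulrCA.
by rewrite big_split /= -mulr_suml (P_sum1 HP) mul1r.
Qed.

End MgfBound.

(** * Counting channel uses *)

Section SlotCounts.
Variables (m n NB : nat) (l : nat -> nat) (q : 'I_n -> nat).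
Hypothesis slotE : forall i, (i < NB * m.+2)%N -> #|[set t | q t == i]| = l (i %% m.+2).

Lemma card_slot (p : 'I_m.+2) b : (b < NB)%N ->
  #|[set t | (phase m q t == p) && (block m q t == b)]| = l p.
Proof.
move=> bNB; have qlt : (b * m.+2 + p < NB * m.+2)%N.
  by apply: leq_trans (_ : b.+1 * m.+2 <= _)%N; rewrite ?leq_mul2r // mulSn addnC ltn_add2r.
rewrite -[X in l X](modn_small (ltn_ord p)) -(modnMDl b) -(slotE qlt).
apply: eq_card => t; rewrite !inE -val_eqE /=; apply/andP/eqP => [[/eqP tp /eqP tb]|qt].
  by rewrite [LHS](divn_eq _ m.+2) tp -tb.
by rewrite /block qt modnMDl modn_small // divnMDl // divn_small // addn0.
Qed.

(** [g] selects one block per phase: [i + j] for transmitter [j] in [uses_a], and constantly [i] in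
    [uses_b]. *)
Lemma sum_slots (R : pzSemiRingType) (Q : pred 'I_m.+2) (g : 'I_m.+2 -> nat)
    (f : 'I_m.+2 -> R) :
  (forall p, Q p -> (g p < NB)%N) ->
  \sum_(t : 'I_n | Q (phase m q t) && (block m q t == g (phase m q t))) f (phase m q t) =
  \sum_(p | Q p) (l p)%:R * f p.
Proof.
move=> gNB; rewrite (partition_big (phase m q) Q) => [|t /andP[]//].
apply: eq_bigr => p Qp; rewrite -(card_slot p (gNB p Qp)) mulr_natl -sumr_const.
rewrite big_mkcond [RHS]big_mkcond; apply: eq_bigr => t _; rewrite !inE.
by case: (phase m q t =P p) => [->|]; rewrite ?Qp ?andbT ?andbF.
Qed.

Lemma sum_uses_a (R : pzSemiRingType) (f : 'I_m.+2 -> R) (k : 'I_m.+2) i :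
  (i + m < NB)%N ->
  \sum_(t in uses_a q k i) f (phase m q t) =
  \sum_(j : 'I_m.+2 | (j < k)%N) (l (rev_ord j))%:R * f (rev_ord j).
Proof.
move=> iNB; transitivity (\sum_(p | (rev_ord p < k)%N) (l p)%:R * f p); last first.
  rewrite (reindex_inj rev_ord_inj) /=; apply: eq_bigl => j.
  by rewrite -[in RHS](rev_ordK j).
rewrite -(@sum_slots _ _ (fun p => i + rev_ord p)%N) => [|p pk].
  by apply: eq_bigl => t; rewrite inE.
(* A sender below [k <= m + 1] is at most [m], so no block after [i + m] is involved. *)
apply: leq_ltn_trans iNB; rewrite leq_add2l -ltnS.
by apply: leq_trans pk _; rewrite -ltnS.
Qed.

Lemma sum_uses_b (R : pzSemiRingType) (f : 'I_m.+2 -> R) (k : 'I_m.+2) i :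
  (i < NB)%N ->
  \sum_(t in uses_b q k i) f (phase m q t) =
  \sum_(p : 'I_m.+2 | (p < rev_ord k)%N) (l p)%:R * f p.
Proof.
move=> iNB; transitivity (\sum_(p : 'I_m.+2 | (k < rev_ord p)%N) (l p)%:R * f p).
  rewrite -(@sum_slots _ _ (fun p => i)%N) //.
  by apply: eq_bigl => t; rewrite inE.
apply: eq_bigl => p; have := ltn_ord p; have := ltn_ord k; rewrite /=; lia.
Qed.

Lemma card_phase_ge (p : 'I_m.+2) : (NB * l p <= #|[set t | phase m q t == p]|)%N.
Proof.
rewrite -[NB in (NB * _)%N]card_ord -sum_nat_const.
rewrite (eq_bigr (fun b : 'I_NB => \sum_t ((phase m q t == p) && (block m q t == b)) : nat)%N);
  last first.
  move=> b _; rewrite -(card_slot p (ltn_ord b)) -sum1_card big_mkcond.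
  by apply: eq_bigr => t _; rewrite inE; case: (_ && _).
rewrite exchange_big -sum1_card [leqRHS]big_mkcond; apply: leq_sum => t _; rewrite inE.
case: (phase m q t =P p) => _; last by rewrite big1.
have [bl|bg] := ltnP (block m q t) NB.
  rewrite (bigD1 (Ordinal bl)) //= eqxx big1 // => b; rewrite -val_eqE /= eq_sym.
  by move=> /negbTE ->.
by rewrite big1 // => b _; rewrite gtn_eqF // (leq_trans _ bg).
Qed.

End SlotCounts.

(** * Rates and thresholds *)

Lemma sum_round_ge (R : realDomainType) (I : finType) (Q : pred I) (x f : I -> R) (l : I -> nat) :
  (forall j, Q j -> `|(l j)%:R - x j| <= 1) ->
  \sum_(j | Q j) x j * f j - \sum_(j | Q j) `|f j| <= \sum_(j | Q j) (l j)%:R * f j.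
Proof.
move=> lx; rewrite -sumrB ler_sum // => j /lx lxj.
rewrite lerBlDr -lerBlDl -mulrBl; apply: le_trans (ler_norm _) _.
by rewrite normrM distrC ler_piMl.
Qed.

Lemma msize_gt0 (R : realType) (r : R) n : 0 <= r -> (0 < msize r n)%N.
Proof.
move=> r0; rewrite /msize truncn_gt0 -[leLHS](@expR0 R) ler_expR !mulr_ge0 //.
by rewrite ln_ge0 // ler1n.
Qed.

(** With [K] the integer part of [expR x], [K + 1] exceeds [expR x], whose power [D] bounds the
    message count; and [K + 1 <= expR x + 1 <= 2 * expR x]. *)
Lemma digit_alphabet (R : realType) (r : R) (n D : nat) : 0 <= r -> (0 < D)%N ->
  exists K : nat, (msize r n <= K.+1 ^ D)%N /\
    K.+1%:R <= 2 * expR (n%:R * (r * ln 2 / D%:R)).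
Proof.
move=> r0 D0; set x := n%:R * _; exists (Num.truncn (expR x)).
have /andP[h1 h2] := truncn_itv (expR_ge0 x); split; last first.
  rewrite -natr1 [leRHS]mulrC mulr2n mulrDr mulr1 lerD //.
  rewrite -[leLHS](@expR0 R) ler_expR !mulr_ge0 ?invr_ge0 //.
  by rewrite ln_ge0 // ler1n.
rewrite -(ler_nat R) natrX; apply: (@le_trans _ _ (expR (n%:R * r * ln 2))).
  by rewrite truncn_le expR_ge0.
rewrite (_ : n%:R * r * ln 2 = D%:R * x); last first.
  by rewrite /x; field; rewrite pnatr_eq0 -lt0n.
by rewrite expRM_natl lerXn2r ?nnegrE ?expR_ge0 // ltW.
Qed.

Section Rates.
Variables (R : realType) (m : nat) (X Y : 'I_m.+2 -> finType).
Variables (W : channel R X Y) (P : input_distrs R X).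
Hypotheses (HW : stochastic W) (HP : forall p, is_distr (@P p)).

(* [r] and [c] are the rate and the information per channel use. *)
Lemma step_error_le (n : nat) (q : 'I_n -> nat) (U : finType) (T : {set 'I_n})
    (k : 'I_m.+2) (L s c d r K1 : R) :
  0 <= L -> 0 <= s -> s <= 1 -> s * L <= 2^-1 -> 2 * s * L ^+ 2 <= d -> 0 <= d -> 0 <= K1 ->
  (forall (p k : 'I_m.+2) x (yk : Y k), `|ln (@lratio R m X Y W P p k x yk)| <= L) ->
  n%:R * c - K1 <= \sum_(t in T) (mutinf W (@P (phase m q t)) k * ln 2) ->
  r + 3 * d <= c ->
  #|U|%:R <= 2 * expR (n%:R * r) ->
  step_error W P q s (n%:R * (r + d)) U T k <= (expR K1 + 2) * expR (- (s * d)) ^+ n.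
Proof.
move=> L0 s0 s1 sL sLd d0 K10 lnL sumT rc cardU.
have n0 : 0 <= n%:R :> R by [].
rewrite /step_error mulrDl -expRM_natl lerD //.
  apply: (@le_trans _ _ (expR (s * (n%:R * (r + d)) + \sum_(t in T)
      (- s * (mutinf W (@P (phase m q t)) k * ln 2) + 2 * (s * L) ^+ 2)))).
    rewrite expRD ler_wpM2l ?expR_ge0 // expR_sum ler_prod // => t _.
    rewrite (mgf_le HW HP) ?andbT //.
    apply: sumr_ge0 => x _; rewrite mulr_ge0 ?(P_ge0 HP) //.
    by apply: sumr_ge0 => o _; rewrite mulr_ge0 ?(W_ge0 HW) ?expR_ge0.
  rewrite -expRD ler_expR big_split /= -mulr_sumr sumr_const.
  have : (2 * (s * L) ^+ 2) *+ #|T| <= n%:R * (s * d).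
    rewrite -[leLHS]mulr_natl ler_pM //; first by rewrite mulr_ge0 ?sqr_ge0.
      by rewrite ler_nat -[leqRHS]card_ord max_card.
    by have := ler_wpM2l s0 sLd; lra.
  (* The exponent is at most [s * n * (r + d) - s * (n * c - K1) + n * s * d], and [c >= r + 3 * d]
     leaves at most [K1 - n * s * d]. *)
  have h1 := ler_wpM2l s0 sumT; have sK : s * K1 <= K1 by rewrite ler_piMl.
  have h2 := ler_wpM2l (mulr_ge0 s0 n0) rc.
  by move: h1 h2; set S := \sum_(t in T) _; lra.
apply: le_trans (ler_wpM2r (expR_ge0 _) cardU) _.
rewrite -mulrA -expRD ler_pM2l // ler_expR.
(* The candidates contribute [2 * expR (- (n * d))]; [s <= 1] weakens this to the common decay rate
   [s * d]. *)
have : n%:R * (s * d) <= n%:R * d by rewrite ler_wpM2l // ler_piMl.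
lra.
Qed.

Variables (Delta : 'I_m.+2 -> R).
Hypotheses (HD0 : forall p, 0 <= Delta p) (HD1 : \sum_p Delta p = 1).

(** Each slot of phase [p] gets the integer part of [n * Delta p / NB] uses, so the slots fit into
    [n] uses and the rounding error stays bounded as [n] grows. *)
Lemma block_schedule (n NB : nat) : (0 < NB)%N ->
  exists (q : 'I_n -> nat) (l : nat -> nat),
  [/\ (forall t t' : 'I_n, (t <= t')%N -> (q t <= q t')%N),
      (forall i, (i < NB * m.+2)%N -> #|[set t | q t == i]| = l (i %% m.+2)%N),
      (forall p : 'I_m.+2, `|(l p)%:R - n%:R * Delta p / NB%:R| <= 1)
    & (forall p : 'I_m.+2, `|#|[set t | phase m q t == p]|%:R - n%:R * Delta p|
         <= (NB * m.+2)%:R)].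
Proof.
move=> NB0; have NBR : 0 < NB%:R :> R by rewrite ltr0n.
pose x p := n%:R * Delta p / NB%:R.
have x0 p : 0 <= x p by rewrite /x !mulr_ge0 ?invr_ge0.
pose l i := Num.truncn (x (inord i : 'I_m.+2)).
have lp (p : 'I_m.+2) : ((l p)%:R <= x p) /\ (x p < (l p)%:R + 1).
  by rewrite /l inord_val natr1; apply/andP/truncn_itv.
have sumx : \sum_p x p = n%:R / NB%:R.
  by rewrite /x -mulr_suml -mulr_sumr HD1 mulr1.
have suml : (\sum_(i < NB * m.+2) l (i %% m.+2) <= n)%N.
  rewrite sum_modn -(ler_nat R) natrM natr_sum mulrC -ler_pdivlMr // -sumx.
  by apply: ler_sum => p _; case: (lp p).
have [q [qm qE]] := @monotone_schedule _ _ (fun i => l (i %% m.+2)%N) suml.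
exists q, l; split=> // [p|].
  have [h1 h2] := lp p; rewrite -/(x p) ler_norml; apply/andP; split; lra.
pose N p : R := #|[set t | phase m q t == p]|%:R.
have N_ge p : n%:R * Delta p - NB%:R <= N p.
  have := card_phase_ge qE p; rewrite -(ler_nat R) natrM; apply: le_trans.
  have [_ /ltW h] := lp p; rewrite lerBlDr -[X in _ + X]mulr1 -mulrDr.
  by have := ler_wpM2l (ltW NBR) h; rewrite /x mulrC divfK ?gt_eqF.
have Nsum : \sum_p N p = n%:R.
  rewrite /N -natr_sum -[in RHS](card_ord n) -sum1_card; congr (_%:R).
  rewrite (partition_big (phase m q) xpredT) //=; apply: eq_bigr => p _.
  by rewrite -sum1_card; apply: eq_bigl => t; rewrite inE.
move=> p; rewrite -/(N p) ler_norml; apply/andP; split.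
  have h : NB%:R <= (NB * m.+2)%:R :> R by rewrite ler_nat leq_pmulr.
  by have := N_ge p; lra.
(* The counts sum to [n], so the lower bounds for the other [m + 1] phases give the upper bound for
   [p]. *)
have : \sum_(i | i != p) (n%:R * Delta i - NB%:R) <= \sum_(i | i != p) N i.
  by apply: ler_sum => i _; exact: N_ge.
move: Nsum HD1; rewrite (bigD1 p) //= [X in X = 1 -> _](bigD1 p) //= => Np Dp.
rewrite sumrB -mulr_sumr sumr_const cardC1 card_ord /= -mulr_natr.
have -> : \sum_(i | i != p) Delta i = 1 - Delta p by rewrite -Dp; ring.
have -> : \sum_(i | i != p) N i = n%:R - N p by rewrite -Np; ring.
rewrite natrM -[in X in _ -> X](natr1 m.+1).
by lra.
Qed.

End Rates.

(** * Achievability *)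

Section Achievability.
Variables (R : realType) (m : nat) (X Y : 'I_m.+2 -> finType).
Variables (W : channel R X Y) (P : input_distrs R X) (Delta : 'I_m.+2 -> R).
Hypotheses (HW : stochastic W) (HP : forall p, is_distr (@P p)).
Hypotheses (HD0 : forall p, 0 <= Delta p) (HD1 : \sum_p Delta p = 1).

(** A bound, independent of [n], on the information lost by rounding slot lengths. *)
Definition info_total : R :=
  \sum_(k : 'I_m.+2) \sum_(p : 'I_m.+2) `|mutinf W (@P p) k * ln 2|.

Lemma info_total_ge k : \sum_p `|mutinf W (@P p) k * ln 2| <= info_total.
Proof.
rewrite /info_total [leRHS](bigD1 k) //= lerDl.
by apply: sumr_ge0 => j _; apply: sumr_ge0.
Qed.

Section OneLength.
Variables (n NB : nat) (q : 'I_n -> nat) (l : nat -> nat).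
Hypothesis slotE : forall i, (i < NB * m.+2)%N -> #|[set t | q t == i]| = l (i %% m.+2)%N.
Hypothesis roundE : forall p : 'I_m.+2, `|(l p)%:R - n%:R * Delta p / NB%:R| <= 1.

Lemma info_uses_a (k : 'I_m.+2) i : (i + m < NB)%N ->
  n%:R * (bound_a W P Delta k * ln 2 / NB%:R) - info_total <=
  \sum_(t in uses_a q k i) (mutinf W (@P (phase m q t)) k * ln 2).
Proof.
move=> iNB; rewrite (sum_uses_a slotE (fun p => mutinf W (@P p) k * ln 2)) //.
pose f (j : 'I_m.+2) := mutinf W (@P (rev_ord j)) k * ln 2.
have := @sum_round_ge R _ (fun j : 'I_m.+2 => (j < k)%N)
  (fun j => n%:R * Delta (rev_ord j) / NB%:R) f
  (fun j => l (rev_ord j)) (fun j _ => roundE (rev_ord j)).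
apply: le_trans; apply: lerB.
  rewrite /bound_a !mulr_suml mulr_sumr le_eqVlt; apply/orP; left; apply/eqP.
  by apply: eq_bigr => j _; rewrite /f; ring.
apply: le_trans (info_total_ge k); rewrite [leRHS](reindex_inj rev_ord_inj) /=.
rewrite [leLHS]big_mkcond; apply: ler_sum => j _; by case: ifP.
Qed.

Lemma info_uses_b (k : 'I_m.+2) i : (i < NB)%N ->
  n%:R * (bound_b W P Delta (rev_ord k) * ln 2 / NB%:R) - info_total <=
  \sum_(t in uses_b q k i) (mutinf W (@P (phase m q t)) k * ln 2).
Proof.
move=> iNB; rewrite (sum_uses_b slotE (fun p => mutinf W (@P p) k * ln 2)) //.
pose f (p : 'I_m.+2) := mutinf W (@P p) k * ln 2.
have := @sum_round_ge R _ (fun p : 'I_m.+2 => (p < rev_ord k)%N)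
  (fun p => n%:R * Delta p / NB%:R) f (fun p => l p) (fun p _ => roundE p).
apply: le_trans; apply: lerB.
  rewrite /bound_b rev_ordK !mulr_suml mulr_sumr le_eqVlt; apply/orP; left; apply/eqP.
  by apply: eq_bigr => j _; rewrite /f; ring.
apply: le_trans (info_total_ge k).
rewrite [leLHS]big_mkcond; apply: ler_sum => j _; by case: ifP.
Qed.

End OneLength.

Lemma codes_exist (Ra Rb : R) : 0 <= Ra -> 0 <= Rb ->
  (forall k : 'I_m.+2, (1 <= k)%N -> Ra < bound_a W P Delta k) ->
  (forall k : 'I_m.+2, (1 <= k)%N -> Rb < bound_b W P Delta k) ->
  exists (C1 C2 x : R), 0 < x /\ forall n : nat,
  exists c : Defs.code X Y n (msize Ra n) (msize Rb n),
  [/\ valid_code c,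
      forall p, `|(nphase c p)%:R - n%:R * Delta p| <= C1,
      err_a c W <= C2 * expR (- x) ^+ n
    & err_b c W <= C2 * expR (- x) ^+ n].
Proof.
move=> Ra0 Rb0 HRa HRb.
have ln20 : 0 < ln 2 :> R by rewrite ln_gt0 // ltr1n.
have [ba ba0 HBa] : exists2 b, 0 < b &
    forall k : 'I_m.+2, (1 <= k)%N -> b <= bound_a W P Delta k - Ra.
  by apply: finite_pos_lower_bound => k /HRa; rewrite subr_gt0.
have [bb bb0 HBb] : exists2 b, 0 < b &
    forall k : 'I_m.+2, (1 <= k)%N -> b <= bound_b W P Delta k - Rb.
  by apply: finite_pos_lower_bound => k /HRb; rewrite subr_gt0.
(* A positive margin below both [ba] and [bb]. *)
pose be := ba * bb / (ba + bb).
have be0 : 0 < be by rewrite /be divr_gt0 ?mulr_gt0 ?addr_gt0.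
have beba : be <= ba by rewrite /be ler_pdivrMr ?addr_gt0 //; nra.
have bebb : be <= bb by rewrite /be ler_pdivrMr ?addr_gt0 //; nra.
(* [D] digits travel in [D + m] blocks: the rate loss vanishes for large [D]. *)
pose z := m%:R * (Ra + Rb) / be.
have z0 : 0 <= z by rewrite /z !mulr_ge0 ?invr_ge0 ?addr_ge0 // ltW.
pose D := (Num.truncn z).+1; pose NB := (D + m)%N.
have zD : m%:R * (Ra + Rb) < D%:R * be.
  by rewrite -ltr_pdivrMr //; have /andP[] := truncn_itv z0.
have D0 : 0 < D%:R :> R by [].
have NB0 : 0 < NB%:R :> R by [].
have NBE : NB%:R = D%:R + m%:R :> R by rewrite natrD.
(* A third of a gap between information and rate per digit that is valid for both messages: the
   threshold, the quadratic remainder and the final decay each take one [d]. *)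
pose d := (D%:R * be - m%:R * (Ra + Rb)) / (NB%:R * D%:R) * ln 2 / 3.
have d0 : 0 < d by rewrite /d !mulr_gt0 ?invr_gt0 ?mulr_gt0 ?subr_gt0.
have m0 : 0 <= m%:R :> R by [].
have gap (r bd : R) : r <= Ra + Rb -> be <= bd - r ->
    r * ln 2 / D%:R + 3 * d <= bd * ln 2 / NB%:R.
  move=> r1 r2; rewrite -subr_ge0.
  have -> : bd * ln 2 / NB%:R - (r * ln 2 / D%:R + 3 * d) =
     (D%:R * (bd - r - be) + m%:R * (Ra + Rb - r)) / (NB%:R * D%:R) * ln 2.
    by rewrite /d NBE; field; rewrite -NBE !gt_eqF.
  by rewrite !mulr_ge0 ?invr_ge0 ?addr_ge0 ?mulr_ge0 ?subr_ge0 // ltW.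
have [L L0 lnL] := lratio_bounded W P.
(* [S] dominates 1, [2 * L] and [2 * L ^+ 2 / d], so its inverse [s] meets the three smallness
   conditions at once. *)
pose S := 1 + 2 * L + 2 * L ^+ 2 / d.
have Ld0 : 0 <= 2 * L ^+ 2 / d by rewrite !mulr_ge0 ?exprn_ge0 ?invr_ge0 // ltW.
have S1 : 1 <= S by rewrite /S -addrA lerDl addr_ge0 // mulr_ge0.
have S0 : 0 < S by apply: lt_le_trans S1.
pose s := S^-1.
have s0 : 0 < s by rewrite invr_gt0.
have s1 : s <= 1 by rewrite invf_le1.
have sL : s * L <= 2^-1.
  rewrite /s mulrC ler_pdivrMr // ler_pdivlMl // /S; lra.
have sLd : 2 * s * L ^+ 2 <= d.
  rewrite /s mulrAC ler_pdivrMr // -ler_pdivrMl // mulrC /S; lra.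
pose C3 := expR info_total + 2.
have C30 : 0 <= C3 by rewrite addr_ge0 ?expR_ge0.
pose C2 := \sum_(k : 'I_m.+2) \sum_(i < D) (C3 + C3).
exists (NB * m.+2)%:R, C2, (s * d); split; first by rewrite mulr_gt0.
move=> n; have [q [l [qm slotE roundE phaseE]]] := block_schedule HD0 HD1 n (ltn0Sn _ : (0 < NB)%N).
have [Ka [MaK KaR]] := digit_alphabet n Ra0 (ltn0Sn _ : (0 < D)%N).
have [Kb [MbK KbR]] := digit_alphabet n Rb0 (ltn0Sn _ : (0 < D)%N).
have [da [da_out da_inj]] := digit_expansion MaK.
have [db [db_out db_inj]] := digit_expansion MbK.
pose ga := n%:R * (Ra * ln 2 / D%:R + d); pose gb := n%:R * (Rb * ln 2 / D%:R + d).
have [c [cv labc ea eb]] := df_code_exists HW HP qm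
  (Ordinal (msize_gt0 n Ra0)) (Ordinal (msize_gt0 n Rb0))
  da_out db_out da_inj db_inj ga gb (ltW s0).
have It0 : 0 <= info_total by apply: sumr_ge0 => k _; apply: sumr_ge0.
suff dfe : df_error W P D q 'I_Ka.+1 'I_Kb.+1 ga gb s <= C2 * expR (- (s * d)) ^+ n.
  exists c; split=> //.
  - move=> p; rewrite /nphase labc.
    (* [nphase] counts a classical set, [phaseE] a finite one. *)
    rewrite (_ : #|_| = #|[set t | phase m q t == p]|); first exact: phaseE.
    apply: eq_card => t; rewrite [RHS]inE.
    by apply/idP/idP => [/set_mem //|tp]; exact: mem_set.
  - exact: le_trans ea dfe.
  - exact: le_trans eb dfe.
have e0 : 0 <= expR (- (s * d)) ^+ n by rewrite exprn_ge0 ?expR_ge0.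
rewrite /df_error /C2 mulr_suml ler_sum // => k _; rewrite mulr_suml ler_sum // => i _.
rewrite mulrDl; apply: lerD.
  case: (ltnP 0 k) => k0; last by rewrite mul0r mulr_ge0.
  rewrite mul1r; apply: (step_error_le HW HP L0 (ltW s0) s1 sL sLd (ltW d0) It0 lnL
    (info_uses_a slotE roundE k (i := i) _)) => //.
  - by rewrite ltn_add2r.
  - by apply: gap; [rewrite lerDl | exact: le_trans beba (HBa k k0)].
  - by rewrite card_ord.
case: (ltnP k m.+1) => km; last by rewrite mul0r mulr_ge0.
rewrite mul1r; apply: (step_error_le HW HP L0 (ltW s0) s1 sL sLd (ltW d0) It0 lnL
  (info_uses_b slotE roundE k (i := i) _)) => //.
- by apply: leq_trans (ltn_ord i) _; rewrite leq_addr.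
- apply: gap; first by rewrite lerDr.
  by apply: le_trans bebb (HBb _ _); rewrite /= subSS subn_gt0.
- by rewrite card_ord.
Qed.

End Achievability.

Theorem theorem6 (R : realType) (m : nat) (hm : (1 < m)%N)
  (X Y : 'I_m.+2 -> finType) (W : channel R X Y) (HW : stochastic W)
  (Delta : 'I_m.+2 -> R) (HD0 : forall p, 0 <= Delta p)
  (HD1 : \sum_(p : 'I_m.+2) Delta p = 1)
  (P : input_distrs R X) (HP : forall p, is_distr (P p))
  (Ra Rb : R) (HRa0 : 0 <= Ra) (HRb0 : 0 <= Rb)
  (HRa : forall k : 'I_m.+2, (1 <= k)%N -> Ra < bound_a W P Delta k)
  (HRb : forall k : 'I_m.+2, (1 <= k)%N -> Rb < bound_b W P Delta k) :
  achievable W Delta Ra Rb.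
Proof.
have [C1 [C2 [x [x0 codes]]]] := codes_exist HW HP HD0 HD1 HRa0 HRb0 HRa HRb.
pose C n := projT1 (cid (codes n)); have CP n := projT2 (cid (codes n)).
have jprob_ge0 n wa wb y : 0 <= jprob (C n) W wa wb y.
  rewrite /jprob mulr_ge0 ?invr_ge0 ?mulr_ge0 // prodr_ge0 // => t _.
  exact: (W_ge0 HW).
exists C; split.
- by move=> n; have [] := CP n.
- move=> p; have C1_0 : 0 <= C1 by have [_ h _ _] := CP 0%N; exact: le_trans (h p).
  (* Phase counts are off by at most the constant [C1], hence frequencies by at most [C1 / n]. *)
  apply/cvgrPdist_le => e e0; near=> n.
  have n0 : 0 < n%:R :> R by rewrite ltr0n; near: n; exact: nbhs_infty_gt.
  have [_ /(_ p) h _ _] := CP n.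
  have -> : Delta p - (nphase (C n) p)%:R / n%:R =
      - ((nphase (C n) p)%:R - n%:R * Delta p) / n%:R.
    by field; rewrite gt_eqF.
  rewrite normrM normrN normfV (ger0_norm (ltW n0)) ler_pdivrMr //.
  apply: le_trans h _; rewrite mulrC -ler_pdivrMr //.
  near: n; exact: nbhs_infty_ger.
- apply: (squeeze_cvgr _ (cvg_cst 0) (exp_decay_cvg0 C2 x0)).
  near=> n; have [_ _ -> _] := CP n; rewrite andbT.
  by do 3!apply: sumr_ge0 => ? _.
- apply: (squeeze_cvgr _ (cvg_cst 0) (exp_decay_cvg0 C2 x0)).
  near=> n; have [_ _ _ ->] := CP n; rewrite andbT.
  by do 3!apply: sumr_ge0 => ? _.
Unshelve. all: by end_near.
Qed.
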